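(* There exists $\epsilon_0>0$ such that the following holds for every constant $0<\epsilon<\epsilon_0$. Let $d=d(n)$ satisfy $d=o(n)$ and $d\ge 3$, and let $p=\frac{1-\epsilon}{d}$. Let $G=(V,E)$ be any $d$-regular graph on $n$ vertices. Then, with high probability, every connected component of the induced subgraph $G[V_p]$ has at most $\frac{4}{\epsilon^2}\ln\left(\frac{n}{d}\right)$ vertices.
   Context: For a vertex set $V$ and $p\in[0,1]$, $V_p$ denotes the random subset of $V$ obtained by including each vertex independently with probability $p$; $G[V_p]$ is the subgraph of $G$ induced by $V_p$. ''With high probability'' means with probability tending to $1$ as $n\to\infty$. *)

(* Defs.v *)
From HB Require Import structures.
From mathcomp Require Import all_boot all_order all_algebra.
From mathcomp Require Import all_classical all_reals all_analysis.
Set Implicit Arguments.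
Unset Strict Implicit.
Unset Printing Implicit Defensive.
Import Order.TTheory GRing.Theory Num.Theory.
Local Open Scope ring_scope.

Definition simple_graph (V : finType) (e : rel V) : Prop :=
  symmetric e /\ irreflexive e.

Definition regular_graph (V : finType) (e : rel V) (d : nat) : Prop :=
  forall v : V, #|[set w | e v w]| = d.

Definition induced_subgraph (V : finType) (e : rel V) (S : {set V}) :
    rel {x : V | x \in S} :=
  fun x y => e (val x) (val y).
Arguments induced_subgraph {V} e S.

Definition graph_components (V : finType) (e : rel V) : {set {set V}} :=
  equivalence_partition (connect e) [set: V].

(* Product Bernoulli(p) law: probability that V_p satisfies A. *)
Definition prob_subset (R : realType) (V : finType) (p : R)
    (A : pred {set V}) : R :=
  \sum_(S : {set V} | A S) \prod_(v : V) (if v \in S then p else 1 - p).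

Lemma prob_subsetT (R : realType) (V : finType) (p : R) :
  prob_subset p (fun _ : {set V} => true) = 1.
Proof.
transitivity (\prod_(v : V) (p + (1 - p))).
  by rewrite bigA_distr; apply: eq_bigl.
by rewrite big1 // => v _; rewrite addrC subrK.
Qed.

(* Main.v *)
Require Import Defs.
From HB Require Import structures.
From mathcomp Require Import all_boot all_order all_algebra.
From mathcomp Require Import all_classical all_reals all_analysis.
From mathcomp Require Import lra ring.

(** The component of [v] in [G[V_p]] equals a connected set [T] of size [k] with
    probability [p^k (1-p)^m], where [m] is the size of the outer boundary of
    [T].  When [k >= 2] every vertex of [T] has a neighbour in [T], so
    [m <= (d-1) k], and passing from [p = (1-eps)/d] to the critical density
    [q = 1/d] changes this weight by a factor at most
    [((1-eps) exp eps)^k <= exp (- eps^2 k / 2)].  For fixed [v] the weights at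
    [q] are probabilities of disjoint events, all contained in [v \in V_q], so
    they sum to at most [1/d].  A union bound over [v] gives probability at
    most [(n/d) exp (- eps^2 K / 2)] for a component larger than [K], which is
    [d/n] when [K = 4 / eps^2 * ln (n/d)]. *)

Set Implicit Arguments.
Unset Strict Implicit.
Unset Printing Implicit Defensive.
Import Order.TTheory GRing.Theory Num.Theory.
Import numFieldNormedType.Exports.
Local Open Scope ring_scope.

(** * Unions, disjoint events and cylinders under the product law *)

Lemma subset_weight_ge0 (R : realType) (V : finType) (p : R) (S : {set V}) :
  0 <= p <= 1 -> 0 <= \prod_(v : V) (if v \in S then p else 1 - p).
Proof.
move=> /andP[p0 p1]; apply: prodr_ge0 => v _.
by case: ifP => _ //; rewrite subr_ge0.
Qed.

Lemma prob_subsetC (R : realType) (V : finType) (p : R) (A : pred {set V}) :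
  prob_subset p A = 1 - prob_subset p (predC A).
Proof.
apply/eqP; rewrite eq_sym subr_eq -(prob_subsetT V p) /prob_subset.
by rewrite (bigID A) /=.
Qed.

Lemma prob_subset_union (R : realType) (V I : finType) (p : R)
    (A : pred {set V}) (P : pred I) (B : I -> pred {set V}) :
  0 <= p <= 1 -> (forall S, A S -> exists2 i, P i & B i S) ->
  prob_subset p A <= \sum_(i | P i) prob_subset p (B i).
Proof.
move=> p01 AB; rewrite /prob_subset.
rewrite (exchange_big_dep xpredT) //= big_mkcond /=; apply: ler_sum => S _.
have w0 := subset_weight_ge0 S p01.
case: ifP => [/AB[i Pi Bi]|_]; last exact: sumr_ge0.
by rewrite (bigD1 i) ?Pi //= lerDl sumr_ge0.
Qed.

Lemma prob_subset_disjoint (R : realType) (V I : finType) (p : R)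
    (A : pred {set V}) (P : pred I) (B : I -> pred {set V}) :
  0 <= p <= 1 -> (forall i S, P i -> B i S -> A S) ->
  (forall i j S, P i -> P j -> B i S -> B j S -> i = j) ->
  \sum_(i | P i) prob_subset p (B i) <= prob_subset p A.
Proof.
move=> p01 BA Bdisj; rewrite /prob_subset.
rewrite (exchange_big_dep xpredT) //= [leRHS]big_mkcond /=.
apply: ler_sum => S _.
have w0 := subset_weight_ge0 S p01.
case: (pickP [pred i | P i && B i S]) => [i /andP[Pi Bi]|none]; last first.
  by rewrite big_pred0 //; case: ifP.
rewrite (BA _ _ Pi Bi) (bigD1 i) ?Pi //= [X in _ + X]big_pred0 ?addr0 // => j.
by apply/negbTE/negP => /andP[/andP[Pj Bj] /eqP]; apply; apply: (Bdisj _ _ S).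
Qed.

(** Giving weight 0 to the forbidden choice at each vertex of [T] or [B] turns the restricted sum
    into a full one, which factors over the vertices; each vertex outside [T] and [B] contributes
    [p + (1 - p) = 1]. *)
Lemma prob_subset_cylinder (R : realType) (V : finType) (p : R)
    (T B : {set V}) : [disjoint T & B] ->
  prob_subset p (fun S => (T \subset S) && [disjoint B & S]) =
  p ^+ #|T| * (1 - p) ^+ #|B|.
Proof.
move=> dTB.
pose F v := if v \in B then 0 else p.
pose G v := if v \in T then 0 else 1 - p.
transitivity (\sum_(S : {set V}) \prod_v (if v \in S then F v else G v)).
  rewrite /prob_subset big_mkcond /=; apply: eq_bigr => S _.
  case: ifP => [/andP[TS dBS]|/negbT].
    apply: eq_bigr => v _; case: ifPn => vS.
      by rewrite /F; case: ifPn => // /(disjointFr dBS); rewrite vS.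
    by rewrite /G; case: ifPn => // /(fintype.subsetP TS); rewrite (negbTE vS).
  rewrite negb_and => /orP[/fintype.subsetPn[v vT vS]|].
    by rewrite (bigD1 v) //= (negbTE vS) /G vT mul0r.
  rewrite -setI_eq0 => /set0Pn[v]; rewrite inE => /andP[vB vS].
  by rewrite (bigD1 v) //= vS /F vB mul0r.
rewrite -bigA_distr -[_ ^+ #|T|]prodr_const -[_ ^+ #|B|]prodr_const.
rewrite [X in _ = X * _]big_mkcond [X in _ = _ * X]big_mkcond -big_split /=.
apply: eq_bigr => v _; rewrite /F /G.
case: (ifPn (v \in T)) => vT; first by rewrite (disjointFr dTB vT) addr0 mulr1.
case: ifP => _; first by rewrite add0r mul1r.
by rewrite mulr1 addrC subrK.
Qed.

(** * Connected sets, their boundaries and components *)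

Definition outer_boundary (V : finType) (e : rel V) (T : {set V}) : {set V} :=
  [set w | (w \notin T) && [exists u in T, e u w]].

(* Connectedness without paths: no proper subset of [T] containing [v] is
   separated from the rest of [T]. *)
Definition rooted_connected (V : finType) (e : rel V) (v : V) (T : {set V}) :=
  (v \in T) && [forall A : {set V},
    [&& v \in A, A \subset T & [disjoint outer_boundary e A & T]] ==> (A == T)].

(** For connected [T] and symmetric [e], this is the event that [T] is a component of the subgraph
    induced by [S], written as a cylinder event. *)
Definition isolated_in (V : finType) (e : rel V) (T S : {set V}) :=
  (T \subset S) && [disjoint outer_boundary e T & S].

Lemma rooted_connected_mem (V : finType) (e : rel V) v (T : {set V}) :
  rooted_connected e v T -> v \in T.
Proof. by case/andP. Qed.

Lemma rooted_connected_min (V : finType) (e : rel V) v (T A : {set V}) :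
  rooted_connected e v T -> v \in A -> A \subset T ->
  (forall u w, u \in A -> w \in T -> e u w -> w \in A) -> A = T.
Proof.
move=> /andP[vT /forallP/(_ A)/implyP connT] vA AT closedA.
apply/eqP/connT; rewrite vA AT /= -setI_eq0.
apply/eqP/setP => w; rewrite !inE; apply/negbTE.
apply/negP => /andP[/andP[wA /existsP[u /andP[uA euw]]] wT].
by rewrite (closedA u w) in wA.
Qed.

(** An edge from [T :&: U] to a vertex of [T] outside [U] would end in the boundary of [U] and in
    [S], which are disjoint. So [T :&: U] is closed in [T] and equals it; the roles of [T] and [U]
    are then exchanged. *)
Lemma isolated_in_inj (V : finType) (e : rel V) v (S T U : {set V}) :
  rooted_connected e v T -> rooted_connected e v U ->
  isolated_in e T S -> isolated_in e U S -> T = U.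
Proof.
move=> cT cU iT iU.
have half X Y : rooted_connected e v X -> rooted_connected e v Y ->
    isolated_in e X S -> isolated_in e Y S -> X :&: Y = X.
  move=> cX cY /andP[XS _] /andP[_ dY].
  apply: (rooted_connected_min cX); rewrite ?finset.subsetIl //.
    by rewrite inE !(rooted_connected_mem cX, rooted_connected_mem cY).
  move=> u w; rewrite !inE => /andP[_ uY] wX euw; rewrite wX /=.
  apply: contraT => wY; have /(fintype.subsetP XS) wS := wX.
  rewrite -(disjointFl dY wS) inE wY.
  by apply/existsP; exists u; rewrite uY.
by rewrite -(half _ _ cT cU) // finset.setIC (half U T).
Qed.

(** If [u] had no neighbour in [T], then [[set v]] (for [u = v]) or [T :\ u] (otherwise) would be
    closed under edges within [T], hence all of [T]. *)
Lemma rooted_connected_neighbour (V : finType) (e : rel V) v (T : {set V}) :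
  symmetric e -> rooted_connected e v T -> (1 < #|T|)%N ->
  forall u, u \in T -> exists2 w, w \in T & e u w.
Proof.
move=> esym cT T1 u uT.
have [|none] := pickP [pred w | (w \in T) && e u w].
  by move=> w /andP[wT euw]; exists w.
exfalso; have [uv|uv] := eqVneq u v.
  have : [set v] = T.
    apply: (rooted_connected_min cT); rewrite ?inE ?finset.sub1set -?uv //.
    by move=> x w; rewrite !inE => /eqP-> wT euw; have /= := none w; rewrite wT euw.
  by move=> TE; rewrite -TE cards1 in T1.
have : T :\ u = T.
  apply: (rooted_connected_min cT); rewrite ?subD1set //.
    by rewrite !inE eq_sym uv (rooted_connected_mem cT).
  move=> x w; rewrite !inE => /andP[_ xT] wT exw; rewrite wT andbT.
  apply/eqP => wu; rewrite wu esym in exw.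
  by have /= := none x; rewrite xT exw.
by move=> TE; rewrite -TE !inE eqxx in uT.
Qed.

(** Each vertex of [T] spends at least one of its [d] edges inside [T]. *)
Lemma card_outer_boundary (V : finType) (e : rel V) d v (T : {set V}) :
  symmetric e -> regular_graph e d -> rooted_connected e v T ->
  (1 < #|T|)%N -> (#|outer_boundary e T| <= d.-1 * #|T|)%N.
Proof.
move=> esym ereg cT T1.
have sub : outer_boundary e T \subset
    \bigcup_(u in T) ([set w | e u w] :\: T).
  apply/fintype.subsetP => w; rewrite inE => /andP[wT /existsP[u /andP[uT euw]]].
  by apply/bigcupP; exists u => //; rewrite !inE wT.
apply: (leq_trans (subset_leq_card sub)).
apply: (@leq_trans (\sum_(u in T) #|[set w | e u w] :\: T|)).
  elim/big_ind2: _ => [|A m B n Am Bn|//]; first by rewrite cards0.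
  by rewrite cardsU (leq_trans (leq_subr _ _)) // leq_add.
rewrite mulnC -sum_nat_const; apply: leq_sum => u uT.
have [w wT euw] := rooted_connected_neighbour esym cT T1 uT.
rewrite -ltnS (leq_trans _ (leqSpred d)) // -(ereg u).
apply: proper_card; apply/properP; split; first exact: finset.subsetDl.
by exists w; rewrite !inE ?wT.
Qed.

Lemma component_isolated (V : finType) (e : rel V) (S : {set V})
    (C : {set {x : V | x \in S}}) :
  C \in graph_components (induced_subgraph e S) ->
  exists v, exists2 T : {set V},
    rooted_connected e v T && isolated_in e T S & #|T| = #|C|.
Proof.
move=> /imsetP[x _ ->]; set D := (X in #|X|).
have xD : x \in D by rewrite !inE connect0.
exists (val x), (val @: D); last by rewrite card_imset //; exact: val_inj.
(* Maximality of the component: it absorbs every vertex of [S] adjacent to it. *)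
have DP w : w \in S -> (exists2 u, u \in D & e (val u) w) -> w \in val @: D.
  move=> wS [u]; rewrite !inE => xu euw; apply/imsetP.
  exists (exist _ w wS) => //; rewrite !inE.
  by apply: connect_trans xu _; apply: connect1.
apply/andP; split; last first.
  apply/andP; split.
    by apply/fintype.subsetP => _ /imsetP[u _ ->]; exact: valP.
  rewrite -setI_eq0; apply/eqP/setP => w; rewrite !inE; apply/negbTE/negP.
  move=> /andP[/andP[/negP wD /existsP[_ /andP[/imsetP[u uD ->] euw]]] wS].
  by apply: wD; apply: DP => //; exists u.
apply/andP; split; first exact: imset_f.
apply/forallP => A; apply/implyP => /and3P[xA AD dA].
rewrite finset.eqEsubset AD /=; apply/fintype.subsetP => _ /imsetP[y yD ->].
move: yD; rewrite inE => /andP[_ /connectP[q qpath ->]].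
(* A path from [x] cannot leave [A]: its next vertex lies in the component, which misses the
   boundary of [A]. *)
have step (u w : {x : V | x \in S}) : connect (induced_subgraph e S) x u ->
    val u \in A -> induced_subgraph e S u w -> val w \in A.
  move=> xu uA euw; apply: contraT => wA.
  have wD : val w \in val @: D.
    by apply: DP; [exact: valP|exists u => //; rewrite !inE].
  rewrite -(disjointFl dA wD) inE wA.
  by apply/existsP; exists (val u); rewrite uA.
have run q' z : val z \in A -> connect (induced_subgraph e S) x z ->
    path (induced_subgraph e S) z q' -> val (last z q') \in A.
  elim: q' z => [|w q' IH] z zA xz //= /andP[ezw qpath'].
  apply: IH => //; first exact: step ezw.
  by apply: connect_trans xz _; apply: connect1.
exact: run.
Qed.

(** * Comparison of cylinder weights at two densities *)

(** The function [(1 - t) * expR (t + t ^+ 2 / 2)] is 1 at 0 and has derivative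
    [- t ^+ 2 * expR (t + t ^+ 2 / 2)]. The quadratic term is what survives once the boundary factor
    cancels the linear one. *)
Lemma one_sub_le_expR (R : realType) (x : R) : 0 <= x ->
  1 - x <= expR (- (x + x ^+ 2 / 2)).
Proof.
move=> x0.
pose f (t : R) : R := (1 - t) * expR (t + t ^+ 2 / 2).
have df (t : R) : is_derive t (1 : R) f (- t ^+ 2 * expR (t + t ^+ 2 / 2)).
  rewrite /f; apply: is_derive_eq.
  by rewrite /GRing.scale /= mulr0; field.
have : f x <= f 0.
  apply: (@ler0_derive1_nincr _ f 0 x) => //.
  - move=> t _; rewrite derive1E derive_val mulNr oppr_le0.
    by rewrite mulr_ge0 ?expR_ge0 ?sqr_ge0.
  - by apply: continuous_subspaceT => t; apply: differentiable_continuous;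
      apply/derivable1_diffP; case: (df t).
rewrite /f expr0n /= mul0r addr0 expR0 subr0 mulr1 expRN => h.
by rewrite -[leRHS]mul1r ler_pdivlMr ?expR_gt0.
Qed.

(* The comparison is with the critical density [1 / d], for which
   [(1 - p) / (1 - q) = 1 + eps / (d - 1)]. *)
Lemma cylinder_weight_le (R : realType) (eps : R) (d k m : nat) :
  0 < eps < 1 -> (1 < d)%N -> (m <= d.-1 * k)%N ->
  ((1 - eps) / d%:R) ^+ k * (1 - (1 - eps) / d%:R) ^+ m <=
  expR (- (eps ^+ 2 / 2 * k%:R)) *
  ((d%:R^-1) ^+ k * (1 - d%:R^-1) ^+ m).
Proof.
move=> /andP[e0 e1] d1 mk.
have dE : d%:R = 1 + d.-1%:R :> R by rewrite nat1r prednK // ltnW.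
set D : R := d.-1%:R in dE.
have D0 : 0 < D by rewrite ltr0n -ltnS prednK // ltnW.
rewrite dE.
have -> : 1 - (1 - eps) / (1 + D) = (1 + eps / D) * (1 - (1 + D)^-1).
  by field; lra.
have q0 : 0 <= 1 - (1 + D)^-1.
  by rewrite subr_ge0 invf_le1; lra.
rewrite exprMn [in X in _ * X]exprMn mulrACA; apply: ler_wpM2r.
  by rewrite mulr_ge0 ?exprn_ge0 // invr_ge0; lra.
have eD : 0 <= eps / D by rewrite divr_ge0 ?ltW.
have bd1 : (1 - eps) ^+ k <= expR (- (eps + eps ^+ 2 / 2)) ^+ k.
  by apply: lerXn2r; rewrite ?nnegrE ?expR_ge0 ?one_sub_le_expR ?subr_ge0 ?ltW.
(* With at most [d - 1] boundary vertices per vertex of [T], the gain per vertex is at most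
   [(1 + eps / D) ^+ d.-1], where [D = d - 1]. *)
have bd2 : (1 + eps / D) ^+ m <= expR eps ^+ k.
  apply: (@le_trans _ _ ((1 + eps / D) ^+ (d.-1 * k))).
    by apply: ler_weXn2l => //; rewrite lerDl.
  rewrite exprM; apply: lerXn2r; rewrite ?nnegrE ?expR_ge0 ?exprn_ge0 ?addr_ge0 //.
  apply: (@le_trans _ _ (expR (eps / D) ^+ d.-1)).
    by apply: lerXn2r; rewrite ?nnegrE ?expR_ge0 ?addr_ge0 ?expR_ge1Dx.
  by rewrite -expRM_natl mulrC divfK // gt_eqF.
apply: (le_trans (ler_pM _ _ bd1 bd2)).
- by rewrite exprn_ge0 // subr_ge0 ltW.
- by rewrite exprn_ge0 // addr_ge0.
by rewrite -exprMn -expRD -expRM_natl ler_expR; lra.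
Qed.

(** * Bounds for one root and for all roots *)

Lemma prob_rooted_component (R : realType) (V : finType) (e : rel V) (d : nat)
    (eps K : R) (v : V) :
  simple_graph e -> regular_graph e d -> (1 < d)%N -> 0 < eps < 1 -> 1 <= K ->
  \sum_(T : {set V} | rooted_connected e v T && (K < #|T|%:R))
    prob_subset ((1 - eps) / d%:R) (isolated_in e T) <=
  expR (- (eps ^+ 2 / 2 * K)) / d%:R.
Proof.
move=> [esym _] ereg d1 eps01 K1.
have dT (T : {set V}) : [disjoint T & outer_boundary e T].
  rewrite -setI_eq0; apply/eqP/setP => w; rewrite !inE.
  by case: (w \in T).
have q01 : 0 <= (d%:R^-1 : R) <= 1.
  by rewrite invr_ge0 ler0n invf_le1 ?ler1n ?ltr0n ltnW.
(* The factor [1 / d] is read as the probability at density [1 / d] of an event containing all the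
   disjoint events for the root [v]. *)
have qE : (d%:R^-1 : R) = prob_subset d%:R^-1 (fun S : {set V} => v \in S).
  have d0 : [disjoint [set v] & (finset.set0 : {set V})].
    by rewrite -setI_eq0 finset.setI0.
  have := prob_subset_cylinder (d%:R^-1 : R) d0.
  rewrite cards1 cards0 expr1 expr0 mulr1 => {1}<-; apply: eq_bigl => S.
  by rewrite finset.sub1set -setI_eq0 finset.set0I eqxx andbT.
rewrite [X in _ <= _ * X]qE.
apply: (@le_trans _ _ (expR (- (eps ^+ 2 / 2 * K)) *
   \sum_(T : {set V} | rooted_connected e v T && (K < #|T|%:R))
     prob_subset d%:R^-1 (isolated_in e T))); last first.
  rewrite ler_wpM2l ?expR_ge0 //; apply: prob_subset_disjoint => //.
    move=> T S /andP[cT _] /andP[/fintype.subsetP TS _].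
    exact: TS (rooted_connected_mem cT).
  by move=> T U S /andP[cT _] /andP[cU _]; apply: isolated_in_inj cT cU.
rewrite mulr_sumr; apply: ler_sum => T /andP[cT KT].
(* [1 <= K] excludes singletons, whose boundary has [d] vertices rather than [d - 1]. *)
have T1 : (1 < #|T|)%N by rewrite -(ltr1n R) (le_lt_trans K1).
rewrite /isolated_in !prob_subset_cylinder //.
apply: (le_trans (cylinder_weight_le eps01 d1
  (card_outer_boundary esym ereg cT T1))).
apply: ler_wpM2r.
  by case/andP: q01 => q0 q1; rewrite mulr_ge0 ?exprn_ge0 ?subr_ge0.
rewrite ler_expR lerN2; apply: ler_wpM2l (ltW KT).
by rewrite divr_ge0 ?sqr_ge0.
Qed.

Lemma prob_components_le (R : realType) (V : finType) (e : rel V) (d : nat)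
    (eps K : R) :
  simple_graph e -> regular_graph e d -> (1 < d)%N -> 0 < eps < 1 -> 1 <= K ->
  1 - #|V|%:R / d%:R * expR (- (eps ^+ 2 / 2 * K)) <=
  prob_subset ((1 - eps) / d%:R) (fun S : {set V} =>
    [forall C in graph_components (induced_subgraph e S), #|C|%:R <= K]).
Proof.
move=> esimple ereg d1 eps01 K1.
rewrite prob_subsetC lerD2l lerN2.
have p01 : 0 <= (1 - eps) / d%:R <= 1.
  case/andP: eps01 => e0 e1; rewrite divr_ge0 ?subr_ge0 ?(ltW e1) //=.
  have d1R : 1 <= d%:R :> R by rewrite ler1n ltnW.
  by rewrite ler_pdivrMr; lra.
apply: (@le_trans _ _ (\sum_(vT : V * {set V} |
    rooted_connected e vT.1 vT.2 && (K < #|vT.2|%:R))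
    prob_subset ((1 - eps) / d%:R) (isolated_in e vT.2))).
  apply: prob_subset_union => // S /=; rewrite negb_forall => /existsP[C].
  rewrite negb_imply -ltNge => /andP[/component_isolated[v [T /andP[cT iT] TC]]].
  by rewrite -TC => KT; exists (v, T); rewrite /= ?cT.
rewrite -(pair_big_dep xpredT
  (fun v T => rooted_connected e v T && (K < #|T|%:R))
  (fun _ T => prob_subset ((1 - eps) / d%:R) (isolated_in e T))) /=.
apply: (@le_trans _ _ (\sum_(v : V) expR (- (eps ^+ 2 / 2 * K)) / d%:R)).
  by apply: ler_sum => v _; apply: prob_rooted_component.
by rewrite sumr_const -[leLHS]mulr_natl mulrA mulrAC.
Qed.

(** * Choice of constants and the limit in [n] *)

Local Open Scope classical_set_scope.

Theorem theorem1 (R : realType) :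
  exists eps0 : R, 0 < eps0 /\
  forall eps : R, 0 < eps < eps0 ->
  forall d : nat -> nat,
    (fun n : nat => (d n)%:R : R^o) =o_\oo (fun n : nat => n%:R : R^o) ->
    (forall n : nat, (3 <= d n)%N) ->
  forall delta : R, 0 < delta ->
  \forall n \near \oo,
    forall (V : finType) (e : rel V),
      #|V| = n -> simple_graph e -> regular_graph e (d n) ->
      1 - delta <=
        prob_subset ((1 - eps) / (d n)%:R)
          (fun S : {set V} =>
             [forall C in graph_components (induced_subgraph e S),
                #|C|%:R <= 4 / eps ^+ 2 * ln (n%:R / (d n)%:R)]).
Proof.
exists 1; split=> // eps eps01 d dn d3 delta delta0.
(* In [d <= c * n], the bound [c <= delta] controls the final failure probability [d / n], and
   [c <= expR (-1)] gives [ln (n / d) >= 1], so that the size threshold is at least 1. *)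
have c0 : 0 < Num.min delta (expR (-1)) by rewrite lt_min delta0 expR_gt0.
move/eqoP: dn => /(_ _ c0); apply: filterS => n.
rewrite !ger0_norm ?ler0n // => dn V e Vn esimple ereg.
have d0 : 0 < (d n)%:R :> R by rewrite ltr0n (leq_trans _ (d3 n)).
have n0 : 0 < n%:R :> R.
  by move: (lt_le_trans d0 dn); rewrite pmulr_rgt0.
have x0 : 0 < n%:R / (d n)%:R :> R by rewrite divr_gt0.
have ln1 : 1 <= ln (n%:R / (d n)%:R : R).
  rewrite -ler_expR lnK ?posrE // ler_pdivlMr //.
  rewrite -ler_pdivlMl ?expR_gt0 // -expRN; apply: (le_trans dn).
  by rewrite ler_wpM2r ?ler0n // ge_min lexx orbT.
case/andP: (eps01) => e0 e1.
have e20 : 0 < eps ^+ 2 by rewrite exprn_gt0.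
have e21 : eps ^+ 2 <= 1 by rewrite expr_le1 ?ltW.
apply: le_trans (prob_components_le esimple ereg _ eps01 _); last 2 first.
- exact: leq_trans (d3 n).
- have : 1 <= 4 / eps ^+ 2 by rewrite ler_pdivlMr //; lra.
  by nra.
rewrite lerD2l lerN2 Vn.
(* The constant 4 makes the exponent twice the logarithm: one copy cancels the factor [n / d] of the
   union bound, the other leaves [d / n]. *)
have -> : eps ^+ 2 / 2 * (4 / eps ^+ 2 * ln (n%:R / (d n)%:R)) =
    ln (n%:R / (d n)%:R : R) + ln (n%:R / (d n)%:R : R).
  by field; lra.
rewrite opprD expRD expRN lnK ?posrE // mulrA divff ?gt_eqF // mul1r invf_div.
by rewrite ler_pdivrMr // (le_trans dn) // ler_wpM2r ?ler0n // ge_min lexx.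
Qed.
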